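(* Let $\delta>0$, let $\mu$ be a probability distribution on $\mathbb{R}$, and let $n\ge 1$ be an integer. Then any shift-invariant $n$-sample estimator $e$ satisfies $Q(e)\le S_{\mu,n}$.
   Context: For $\theta\in\mathbb{R}$, $\mu_\theta(A)=\mu(\{x:x+\theta\in A\})$, and $\mu_\theta^n$ is the product measure on $\mathbb{R}^n$ (with $\mu^n=\mu_0^n$). An $n$-sample estimator is a (Borel) measurable function $e:\mathbb{R}^n\to\mathbb{R}$. Its ($\delta$-)quality is $Q(e)=\inf_{\theta\in\mathbb{R}}\mu_\theta^n(\{\mathbf{x}\in\mathbb{R}^n:|e(\mathbf{x})-\theta|<\delta\})$. It is shift-invariant if $e(x_1+c,\ldots,x_n+c)=e(x_1,\ldots,x_n)+c$ for all $c,x_i\in\mathbb{R}$. For $\mathbf{x}=(x_1,\ldots,x_n)\in\mathbb{R}^n$ and $t\in\mathbb{R}$, write $\mathbf{x}+t=(x_1+t,\ldots,x_n+t)$, and for $a<b$ write $\mathbf{x}+(a,b)=\{\mathbf{x}+t: a<t<b\}$. Let $X_0=\{\mathbf{x}\in\mathbb{R}^n:x_1=0\}$. Let $\mathcal{A}$ denote the collection of all Borel subsets $A\subset\mathbb{R}^n$ of the form $A=\bigcup_{\mathbf{x}\in X_0}\mathbf{x}+(f(\mathbf{x})-\delta,f(\mathbf{x})+\delta)$, where $f:X_0\to\mathbb{R}$ is a Borel function, and define $S_{\mu,n}=S_{\mu,n}(\delta)=\sup_{A\in\mathcal{A}}\mu^n(A)$. *)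

(* Defs.v *)
From HB Require Import structures.
From mathcomp Require Import all_boot all_order all_algebra.
From mathcomp Require Import all_classical all_reals all_analysis.

Set Implicit Arguments.
Unset Strict Implicit.
Unset Printing Implicit Defensive.

Import Order.TTheory GRing.Theory Num.Theory.
Import numFieldNormedType.Exports.

Local Open Scope classical_set_scope.
Local Open Scope ring_scope.

(* R^n is n.-tuple R: the library equips it with the sigma-algebra generated
   by the coordinate projections, and R with its Borel sigma-algebra, so that
   the measurable sets of n.-tuple R are the Borel subsets of R^n. *)

Section product_power.
Context d (T : measurableType d) (R : realType).

Definition cons_pair (n : nat) (p : T * n.-tuple T) : n.+1.-tuple T :=
  [tuple of p.1 :: p.2].

Lemma measurable_cons_pair (n : nat) : measurable_fun setT (@cons_pair n).
Proof. exact: measurable_cons. Qed.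

HB.instance Definition _ (n : nat) :=
  isMeasurableFun.Build _ _ _ _ (@cons_pair n) (@measurable_cons_pair n).

(* P^n, by recursion: P^0 is the point mass at the empty tuple, and P^(n+1)
   is P (x) P^n carried along T * T^n ~ T^(n+1). *)
Fixpoint power_prob (P : probability T R) (n : nat) :
    probability (n.-tuple T) R :=
  match n with
  | 0 => \d_([tuple] : 0.-tuple T)
  | m.+1 => distribution (P \x power_prob P m)%E (@cons_pair m)
  end.

Lemma power_prob_box (P : probability T R) (n : nat) (A : 'I_n -> set T) :
  (forall i, measurable (A i)) ->
  power_prob P n [set x | forall i, A i (tnth x i)] =
    (\prod_(i < n) P (A i))%E.
Proof.
elim: n A => [|n IH] A mA /=.
  rewrite big_ord0 diracE; case: (boolP (_ \in _)) => //.
  by rewrite notin_setE => /= -[] [].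
rewrite big_ord_recl -IH; last by move=> i; exact: mA.
rewrite /distribution /pushforward -product_measure1E//; last first.
  rewrite [X in measurable X](_ : _ =
      \big[setI/setT]_(i < n) ((@tnth n T)^~ i @^-1` A (lift ord0 i))).
    apply: bigsetI_measurable => i _.
    by rewrite -[X in measurable X]setTI; exact: measurable_tnth.
  by rewrite -bigcap_seq; apply/seteqP; split=> [x Ax i _|x Ax i] //=;
    apply: Ax => /=; rewrite mem_index_enum.
congr (_ _); apply/seteqP; split=> [[a x] /= H|[a x] /= [Ha Hx] i].
  split; first exact: (H ord0).
  by move=> i; have := H (lift ord0 i); rewrite tnthS.
case: (unliftP ord0 i) => [j ->|-> //].
by rewrite tnthS; exact: Hx.
Qed.

End product_power.

Section estimators.
Context (R : realType).

Definition add_cst (theta x : R) : R := x + theta.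

Lemma measurable_add_cst (theta : R) : measurable_fun setT (add_cst theta).
Proof. exact: measurable_realfun.measurable_funD. Qed.

HB.instance Definition _ (theta : R) :=
  isMeasurableFun.Build _ _ _ _ (add_cst theta) (measurable_add_cst theta).

(* mu_theta(A) = mu {x | x + theta \in A} *)
Definition shift_prob (mu : probability R R) (theta : R) : probability R R :=
  distribution mu (add_cst theta).

Definition shift_tuple (n : nat) (x : n.-tuple R) (t : R) : n.-tuple R :=
  [tuple tnth x i + t | i < n].

Definition shift_invariant (n : nat) (e : n.-tuple R -> R) : Prop :=
  forall (x : n.-tuple R) (c : R), e (shift_tuple x c) = e x + c.

Definition quality (delta : R) (mu : probability R R) (n : nat)
    (e : n.-tuple R -> R) : \bar R :=
  ereal_inf [set power_prob (shift_prob mu theta) n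
                   [set x | `|e x - theta| < delta] | theta in [set: R]].

(* x + (a, b) *)
Definition shift_segment (n : nat) (x : n.-tuple R) (a b : R) :
    set (n.-tuple R) :=
  [set shift_tuple x t | t in `]a, b[].

(* The tuples whose first coordinate is 0; only meaningful for n > 0. *)
Definition X0 (n : nat) : set (n.-tuple R) := [set x | nth 0 x 0%N = 0].

(* A Borel function on X0 is given by a function on n.-tuple R that is
   measurable on X0; its values outside X0 play no role. *)
Definition segment_sets (delta : R) (n : nat) : set (set (n.-tuple R)) :=
  [set A | measurable A /\
    exists f : n.-tuple R -> R,
      measurable_fun (@X0 n) f /\
      A = \bigcup_(x in @X0 n)
            shift_segment x (f x - delta) (f x + delta)].

Definition Ssup (delta : R) (mu : probability R R) (n : nat) : \bar R :=
  ereal_sup [set power_prob mu n A | A in @segment_sets delta n].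

End estimators.

(* Main.v *)
Require Import Defs.
From mathcomp Require Import all_boot all_order all_algebra.
From mathcomp Require Import all_classical all_reals all_analysis.

(** The quality of [e] is an infimum over the translation parameter, so it is
    at most the value at parameter 0, namely [mu^n(A)] with
    [A = {x : |e x| < delta}].  For a shift-invariant [e] this set is itself a
    union of segments: on the diagonal line through [x] the estimator has slope
    one, so it vanishes exactly at [x - e x], and [A] meets that line in the
    segment of half-length [delta] around this zero.  Hence [A] is one of the
    sets in the supremum [Ssup], with centre function [f = - e]. *)

Import Order.TTheory GRing.Theory Num.Theory.
Import numFieldNormedType.Exports.

Local Open Scope classical_set_scope.
Local Open Scope ring_scope.

(** Stated with pointwise equality, so that two probabilities built by
    different constructions, such as [shift_prob mu 0] and [mu], can be
    exchanged without identifying their bundled structures.  In the inductive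
    step the product measure is the [P]-integral of the measures of the
    sections, and both the integrand and the integrating measure are replaced
    through their values on sets. *)
Lemma eq_power_prob d (T : measurableType d) (R : realType)
    (P Q : probability T R) (n : nat) :
  P =1 Q -> power_prob P n =1 power_prob Q n.
Proof.
move=> PQ; elim: n => [|n IH] A //=.
rewrite /distribution /pushforward /product_measure1 /=.
transitivity (\int[P]_x
    (power_prob Q n \o xsection ((@cons_pair _ T n) @^-1` A)) x)%E.
  by apply: eq_integral => x _; rewrite /= IH.
by apply: eq_measure_integral => B _ _; exact: PQ.
Qed.

Lemma shift_prob0 (R : realType) (mu : probability R R) :
  shift_prob mu 0 =1 mu.
Proof.
move=> A; rewrite /shift_prob /distribution /pushforward; congr (mu _).
by apply/seteqP; split=> x /=; rewrite /add_cst addr0.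
Qed.

Lemma shift_tuple_shift (R : realType) (n : nat) (x : n.-tuple R) (s t : R) :
  shift_tuple (shift_tuple x s) t = shift_tuple x (s + t).
Proof. by apply: eq_from_tnth => i; rewrite !tnth_mktuple addrA. Qed.

Lemma shift_tuple0 (R : realType) (n : nat) (x : n.-tuple R) :
  shift_tuple x 0 = x.
Proof. by apply: eq_from_tnth => i; rewrite tnth_mktuple addr0. Qed.

(** This is what makes segments based at points of [X0] able to reach all of
    [R^n]: the diagonal line through [x] contains a point of [X0]. *)
Lemma X0_shift_head (R : realType) (n : nat) (x : n.-tuple R) :
  (0 < n)%N -> X0 (shift_tuple x (- nth 0 x 0)).
Proof.
case: n x => // n x _; rewrite /X0 /=.
by rewrite -(tnth_nth 0 (shift_tuple _ _) ord0) tnth_mktuple (tnth_nth 0) subrr.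
Qed.

Lemma measurable_estimator_ball (R : realType) (delta : R) (n : nat)
    (e : n.-tuple R -> R) :
  measurable_fun [set: n.-tuple R] e -> measurable [set x | `|e x| < delta].
Proof.
move=> me.
rewrite (_ : [set x | _] = [set: n.-tuple R] `&` e @^-1` (ball 0 delta)).
  by apply: me => //; exact: measurable_realfun.measurable_ball.
by rewrite setTI; apply/seteqP; split=> x /=; rewrite /ball /= sub0r normrN.
Qed.

(** A point [x + t] with [x] in [X0] satisfies [e (x + t) = e x + t], so
    [|e (x + t)| < delta] says that [t] is within [delta] of [- e x]. *)
Lemma estimator_ball_segment (R : realType) (delta : R) (n : nat)
    (e : n.-tuple R -> R) :
  (0 < n)%N -> measurable_fun [set: n.-tuple R] e -> shift_invariant e ->
  segment_sets delta [set x | `|e x| < delta].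
Proof.
move=> n0 me he; split; first exact: measurable_estimator_ball.
exists (fun x => - e x); split.
  by apply: measurable_funTS; exact: measurableT_comp.
have seg x t : (t \in `]- e x - delta, - e x + delta[) =
    (`|e (shift_tuple x t)| < delta).
  rewrite he in_itv /= ltr_norml.
  by rewrite [- e x - _]addrC [- e x + _]addrC ltrBlDl ltrBrDl.
apply/seteqP; split=> [y /= ey|_ /= [x _ [t /= xt <-]]]; last by rewrite -seg.
have yE : shift_tuple (shift_tuple y (- nth 0 y 0)) (nth 0 y 0) = y.
  by rewrite shift_tuple_shift addNr shift_tuple0.
exists (shift_tuple y (- nth 0 y 0)); first exact: X0_shift_head.
by exists (nth 0 y 0) => //=; rewrite seg yE.
Qed.

Theorem theorem2 (R : realType) (delta : R) (hdelta : (0 < delta)%R)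
    (mu : probability R R) (n : nat) (hn : (1 <= n)%N)
    (e : n.-tuple R -> R) (me : measurable_fun [set: n.-tuple R]%classic e)
    (he : shift_invariant e) :
  (quality delta mu e <= Ssup delta mu n)%E.
Proof.
have qE : power_prob (shift_prob mu 0) n [set x | `|e x - 0| < delta] =
    power_prob mu n [set x | `|e x| < delta].
  rewrite (eq_power_prob _ _ _ _ _ _ (shift_prob0 R mu)).
  congr (power_prob mu n _).
  by apply/seteqP; split=> x /=; rewrite subr0.
apply: (@le_trans _ _ (power_prob mu n [set x | `|e x| < delta])).
  by apply: ereal_inf_lbound; exists 0.
apply: ereal_sup_ubound; exists [set x | `|e x| < delta] => //.
exact: estimator_ball_segment.
Qed.
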